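(* Let $f:\mathbb{N}_0\to\mathbb{C}$ and $\alpha>0$. Then $$W^\alpha f(n)=\sum_{j=n}^\infty k^{-\alpha}(j-n)f(j),\qquad n\in\mathbb{N}_0,$$ whenever both expressions make sense.
   Context: $\mathbb{N}_0=\{0,1,2,\ldots\}$. For $\gamma\in\mathbb{C}$ put $k^\gamma(0)=1$ and $k^\gamma(n)=\frac{\gamma(\gamma+1)\cdots(\gamma+n-1)}{n!}$ for $n\ge1$. For $\alpha>0$, the Weyl sum is $W^{-\alpha}f(n)=\sum_{j=n}^\infty k^\alpha(j-n)f(j)$, whenever the right-hand side makes sense (the series converges). $W^1f(n)=f(n)-f(n+1)$, and $W^m$ is the $m$-fold iterate of $W^1$ for integers $m\ge1$, i.e. $W^mf(n)=\sum_{j=0}^m(-1)^j\binom mjf(n+j)$. For $\alpha>0$, the Weyl difference is $W^\alpha f(n)=W^mW^{-(m-\alpha)}f(n)$ with $m=[\alpha]+1$, whenever the right-hand side makes sense; for integer $\alpha$ it is the iterated difference just described. *)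

(* Defs.v *)
From Stdlib Require Import Reals Factorial.
From Coquelicot Require Import Coquelicot.

Open Scope R_scope.

(* Total sum of a complex series, in the style of Coquelicot's [RInt]: the
   limit of the partial sums when [ex_series a] holds, unspecified otherwise. *)
Definition CSeries (a : nat -> C) : C :=
  iota (T := C_CompleteNormedModule) (is_series (V := C_NormedModule) a).

(* gamma (gamma + 1) ... (gamma + n - 1); the empty product is 1. *)
Fixpoint rising (gamma : C) (n : nat) : C :=
  match n with
  | O => 1%C
  | S p => (rising gamma p * (gamma + INR p))%C
  end.

Definition kernel (gamma : C) (n : nat) : C :=
  (rising gamma n / INR (fact n))%C.

(* sum_{j >= n} k^gamma(j - n) f(j), reindexed by j = n + i. *)
Definition kernel_terms (gamma : C) (f : nat -> C) (n i : nat) : C :=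
  (kernel gamma i * f (n + i)%nat)%C.

(* W^{-alpha} f(n) and the condition under which it makes sense. *)
Definition weyl_sum_defined (alpha : R) (f : nat -> C) (n : nat) : Prop :=
  ex_series (kernel_terms alpha f n).

Definition weyl_sum (alpha : R) (f : nat -> C) (n : nat) : C :=
  CSeries (kernel_terms alpha f n).

Definition W1 (f : nat -> C) (n : nat) : C := (f n - f (S n))%C.

Definition weyl_diff_nat (m : nat) (f : nat -> C) : nat -> C :=
  Nat.iter m W1 f.

(* [alpha] as a natural number; meant for alpha >= 0. *)
Definition nat_part (alpha : R) : nat := Z.to_nat (Int_part alpha).

Definition weyl_order (alpha : R) : nat := S (nat_part alpha).

(* W^alpha f(n): the iterated difference for integer alpha, and otherwise
   W^m W^{-(m - alpha)} f(n) with m = [alpha] + 1. *)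
Definition weyl_diff (alpha : R) (f : nat -> C) (n : nat) : C :=
  if Req_dec_T alpha (INR (nat_part alpha))
  then weyl_diff_nat (nat_part alpha) f n
  else weyl_diff_nat (weyl_order alpha)
         (weyl_sum (INR (weyl_order alpha) - alpha) f) n.

(* W^m g(n) involves exactly the values g(n), ..., g(n + m), so these are the
   Weyl sums that have to converge; for integer alpha there is no condition. *)
Definition weyl_diff_defined (alpha : R) (f : nat -> C) (n : nat) : Prop :=
  alpha <> INR (nat_part alpha) ->
  forall j : nat, (n <= j <= n + weyl_order alpha)%nat ->
    weyl_sum_defined (INR (weyl_order alpha) - alpha) f j.

(* Main.v *)
(* Since [k^gamma (l + 1) - k^gamma l = k^(gamma - 1) (l + 1)], subtracting the
   Weyl series of exponent [gamma] at [n + 1], shifted by one term, from the one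
   at [n] gives termwise the series of exponent [gamma - 1] at [n].  Iterating
   this starts from exponent [m - alpha] (or from exponent [0], whose series is
   [f n] itself, when [alpha] is an integer) and ends at exponent [- alpha]. *)
Require Import Defs.
From Stdlib Require Import Reals Factorial Lra Lia.
From Coquelicot Require Import Coquelicot.

(** [rising] peels off the last factor; induction is needed to peel off the first one, [gamma - 1],
    instead. *)
Lemma rising_pred (gamma : C) (n : nat) :
  rising (gamma - 1)%C (S n) = ((gamma - 1) * rising gamma n)%C.
Proof.
  induction n as [|n IH].
  - simpl; ring.
  - change (rising (gamma - 1)%C (S (S n)))
      with (rising (gamma - 1)%C (S n) * (gamma - 1 + INR (S n)))%C.
    rewrite IH, S_INR, RtoC_plus; simpl; ring.
Qed.

(** Over the common denominator [(n + 1)!] the right-hand numerator is [rising gamma n] times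
    [(gamma + n) - (n + 1) = gamma - 1]. *)
Lemma kernel_pred (gamma : C) (n : nat) :
  kernel (gamma - 1)%C (S n) = (kernel gamma (S n) - kernel gamma n)%C.
Proof.
  assert (Hn : RtoC (INR (S n)) <> 0%C)
    by (intro H; apply RtoC_inj in H; exact (not_0_INR (S n) (Nat.neq_succ_0 n) H)).
  assert (Hf : RtoC (INR (fact n)) <> 0%C)
    by (intro H; apply RtoC_inj in H; exact (INR_fact_neq_0 n H)).
  unfold kernel.
  rewrite rising_pred, fact_simpl, mult_INR, RtoC_mult.
  change (rising gamma (S n)) with (rising gamma n * (gamma + INR n))%C.
  (* This leaves [INR (S n)] as the only index atom, the one that [Hn] shows to be nonzero for
     [field]. *)
  replace (gamma + INR n)%C with (gamma - 1 + INR (S n))%C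
    by (rewrite S_INR, RtoC_plus; ring).
  field; split; assumption.
Qed.

Lemma kernel_0_l (n : nat) : kernel 0%C n = match n with O => 1%C | S _ => 0%C end.
Proof.
  unfold kernel; destruct n as [|n].
  - simpl; field; apply RtoC_neq; lra.
  - assert (H : rising 0%C (S n) = 0%C)
      by (induction n as [|n IH]; [simpl; ring |
            change (rising 0%C (S n) * (0 + INR (S n)) = 0)%C; rewrite IH; ring]).
    rewrite H; unfold Cdiv; ring.
Qed.

Lemma CSeries_unique (a : nat -> C) (s : C) :
  is_series (V := C_NormedModule) a s -> CSeries a = s.
Proof.
  intro Hs. unfold CSeries.
  apply (iota_unique (V := C_CompleteNormedModule)); [|exact Hs].
  intros y Hy; exact (is_filter_lim_unique (V := C_NormedModule) _ _ Hy Hs).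
Qed.

(** Every partial sum already equals [f n], so convergence holds for any [f]. *)
Lemma is_series_kernel_terms_0 (f : nat -> C) (n : nat) :
  is_series (V := C_NormedModule) (kernel_terms 0%C f n) (f n).
Proof.
  apply filterlim_ext with (f := fun _ : nat => f n); [|apply filterlim_const].
  intro N; induction N as [|N IH].
  - rewrite sum_O; unfold kernel_terms.
    rewrite kernel_0_l, Nat.add_0_r; symmetry; apply Cmult_1_l.
  - rewrite sum_Sn, <- IH; unfold kernel_terms; rewrite kernel_0_l.
    change (f n = f n + 0 * f (n + S N)%nat)%C; ring.
Qed.

Lemma is_series_kernel_terms_pred (gamma : C) (f : nat -> C) (n : nat) (s t : C) :
  is_series (V := C_NormedModule) (kernel_terms gamma f n) s ->
  is_series (V := C_NormedModule) (kernel_terms gamma f (S n)) t ->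
  is_series (V := C_NormedModule) (kernel_terms (gamma - 1)%C f n) (s - t)%C.
Proof.
  (* The term of index 0 is split off because [kernel_pred] only covers positive indices. *)
  intros Hs Ht; apply is_series_decr_1.
  apply is_series_ext with
    (fun i => minus (kernel_terms gamma f n (S i)) (kernel_terms gamma f (S n) i)).
  - intro i; unfold kernel_terms.
    rewrite kernel_pred, Nat.add_succ_r.
    change (kernel gamma (S i) * f (S (n + i)) - kernel gamma i * f (S (n + i)) =
            (kernel gamma (S i) - kernel gamma i) * f (S (n + i)))%C.
    ring.
  - assert (Hs1 : is_series (V := C_NormedModule)
        (fun i => kernel_terms gamma f n (S i)) (s - kernel_terms gamma f n 0)%C).
    { apply (is_series_incr_1 (V := C_NormedModule)).
      match goal with |- is_series _ ?l => replace l with s; [exact Hs|] end.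
      change (s = s - kernel_terms gamma f n 0 + kernel_terms gamma f n 0)%C; ring. }
    match goal with |- is_series _ ?l =>
      replace l with (s - kernel_terms gamma f n 0 - t)%C end.
    + exact (is_series_minus (V := C_NormedModule) _ _ _ _ Hs1 Ht).
    (* The limits match because both terms of index 0 equal [f n], the kernel at 0 being 1 for every
       exponent. *)
    + change (s - kernel_terms gamma f n 0 - t =
              s - t - kernel_terms (gamma - 1)%C f n 0)%C.
      unfold kernel_terms, kernel; simpl; ring.
Qed.

(** Keeping [g] abstract serves both cases of [weyl_diff]: [g] is [f] itself at exponent 0, or a
    Weyl sum of [f]. *)
Lemma is_series_weyl_diff_nat (gamma : C) (f g : nat -> C) (m n : nat) :
  (forall j, (n <= j <= n + m)%nat ->
     is_series (V := C_NormedModule) (kernel_terms gamma f j) (g j)) ->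
  is_series (V := C_NormedModule) (kernel_terms (gamma - INR m)%C f n)
    (weyl_diff_nat m g n).
Proof.
  revert n; induction m as [|m IH]; intros n H.
  - replace (gamma - INR 0)%C with gamma by (simpl; ring).
    apply H; lia.
  - replace (gamma - INR (S m))%C with (gamma - INR m - 1)%C
      by (rewrite S_INR, RtoC_plus; ring).
    (* By conversion, [weyl_diff_nat (S m) g n] is the difference of the order [m] values at [n] and
       [S n]. *)
    apply is_series_kernel_terms_pred; apply IH; intros j Hj; apply H; lia.
Qed.

Theorem theorem3p2 (f : nat -> C) (alpha : R) (halpha : 0 < alpha) (n : nat)
    (hW : weyl_diff_defined alpha f n)
    (hS : ex_series (fun i : nat => (kernel (RtoC (- alpha)) i * f (n + i)%nat)%C)) :
  weyl_diff alpha f n =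
    CSeries (fun i : nat => (kernel (RtoC (- alpha)) i * f (n + i)%nat)%C).
Proof.
  symmetry; apply CSeries_unique.
  change (is_series (V := C_NormedModule) (kernel_terms (RtoC (- alpha)) f n)
            (weyl_diff alpha f n)).
  unfold weyl_diff; destruct (Req_dec_T alpha (INR (nat_part alpha))) as [Ha|Ha].
  - replace (RtoC (- alpha)) with (0 - INR (nat_part alpha))%C
      by (rewrite <- Ha, RtoC_opp; ring).
    apply is_series_weyl_diff_nat; intros j _; apply is_series_kernel_terms_0.
  - replace (RtoC (- alpha))
      with (RtoC (INR (weyl_order alpha) - alpha) - INR (weyl_order alpha))%C
      by (rewrite RtoC_minus, RtoC_opp; ring).
    apply is_series_weyl_diff_nat; intros j Hj.
    (* Convergence at [j] makes the [iota] in [weyl_sum] the actual limit. *)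
    destruct (hW Ha j Hj) as [s Hs].
    unfold weyl_sum; rewrite (CSeries_unique _ _ Hs); exact Hs.
Qed.
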